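(* Let $(\bar A,\bar B,\bar C)$ be a minimal system with $p$ outputs, and suppose that at least one output storage location is unprotected, i.e. $\mathcal U\neq\emptyset$. Then there exist an attack-free dataset $\mathbf D_0$ of $(\bar A,\bar B,\bar C)$, a minimal system $(A',B',C')$, and a nonzero poisoning attack sequence $\mathbf a$ (that is, $\mathbf a\not\equiv 0$ with $\mathbf a_i\equiv 0$ for all $i\in\mathcal S$) such that the poisoned dataset $\mathbf D$ generated by $(A',B',C')$ under the attack $\mathbf a$ satisfies $\mathbf D_0=\mathbf D$. Consequently, for any data-driven attack detector $\mathscr D$ and any data-driven attack identifier $\mathscr I$, $\mathscr D(\mathbf D_0)=\mathscr D(\mathbf D)$ and $\mathscr I(\mathbf D_0)=\mathscr I(\mathbf D)$, so the attack $\mathbf a$ cannot be detected or identified.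
   Context: A system $(A,B,C)$ with $A\in\mathbb R^{n\times n}$, $B\in\mathbb R^{n\times m}$, $C\in\mathbb R^{p\times n}$ (with $n,m,p\ge 1$) denotes the discrete-time LTI system $x(k+1)=Ax(k)+Bu(k)$, $y(k)=Cx(k)$. It is minimal if $(A,B)$ is controllable and $(A,C)$ is observable. The output indices $\mathcal P=\{1,\dots,p\}$ are partitioned into protected indices $\mathcal S=\{1,\dots,s_p\}$ and unprotected indices $\mathcal U=\{s_p+1,\dots,p\}$ ($s_p$ may be $0$). Fix a data length $N\geq 1$. An attack-free dataset of a system is a pair $\mathbf D_0=(\mathbf u,\mathbf y)$ where $\mathbf u=(\mathbf u(0),\dots,\mathbf u(N-1))$ is an input sequence and $\mathbf y=(\mathbf y(0),\dots,\mathbf y(N-1))$ is the output sequence the system produces under $\mathbf u$ from some initial state. A poisoning attack sequence is $\mathbf a=(\mathbf a(0),\dots,\mathbf a(N-1))$ with $\mathbf a(k)\in\mathbb R^p$ and $\mathbf a_i(k)=0$ for all $k$ and all $i\in\mathcal S$; it is otherwise arbitrary. The poisoned dataset generated by a system under attack $\mathbf a$ is $\mathbf D=(\mathbf u,\widetilde{\mathbf y})$ with $\widetilde{\mathbf y}(k)=\mathbf y(k)+\mathbf a(k)$, where $(\mathbf u,\mathbf y)$ is an input-output trajectory of that system over $[0,N-1]$. A data-driven attack detector is an arbitrary map $\mathscr D$ from datasets to $\{\mathrm{Attack},\mathrm{NoAttack}\}$; a data-driven attack identifier is an arbitrary map $\mathscr I$ from datasets to $2^{\mathcal P}$, the power set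 of $\mathcal P$. *)

(* Defs.v *)
From HB Require Import structures.
From mathcomp Require Import all_boot all_order all_algebra.
From mathcomp Require Import reals.

Set Implicit Arguments.
Unset Strict Implicit.
Unset Printing Implicit Defensive.
Import Order.TTheory GRing.Theory Num.Theory.
Local Open Scope ring_scope.

Record lti (R : realType) (n m p : nat) := LTI {
  Amx : 'M[R]_n;
  Bmx : 'M[R]_(n, m);
  Cmx : 'M[R]_(p, n)
}.

Fixpoint state (R : realType) (n m p : nat) (s : lti R n m p)
    (x0 : 'cV[R]_n) (u : nat -> 'cV[R]_m) (k : nat) : 'cV[R]_n :=
  if k is j.+1 then Amx s *m state s x0 u j + Bmx s *m u j else x0.

Definition output (R : realType) (n m p : nat) (s : lti R n m p)
    (x0 : 'cV[R]_n) (u : nat -> 'cV[R]_m) (k : nat) : 'cV[R]_p :=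
  Cmx s *m state s x0 u k.

(* The target state is arbitrary, not just the origin: for singular A,
   null-controllability is strictly weaker in discrete time and is not the
   notion that enters minimality. *)
Definition controllable (R : realType) (n m p : nat) (s : lti R n m p) : Prop :=
  forall x0 xf : 'cV[R]_n,
    exists (T : nat) (u : nat -> 'cV[R]_m), state s x0 u T = xf.

Definition observable (R : realType) (n m p : nat) (s : lti R n m p) : Prop :=
  exists T : nat, forall (u : nat -> 'cV[R]_m) (x0 x1 : 'cV[R]_n),
    (forall k, (k < T)%N -> output s x0 u k = output s x1 u k) -> x0 = x1.

Definition minimal (R : realType) (n m p : nat) (s : lti R n m p) : Prop :=
  controllable s /\ observable s.

(* Indices are 0-based: {1, ..., sp} is the set of i : 'I_p with i < sp. *)
Definition protected (p sp : nat) : {set 'I_p} := [set i : 'I_p | (i < sp)%N].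

Definition unprotected (p sp : nat) : {set 'I_p} := ~: protected p sp.

(* Finite functions, so that Leibniz equality of datasets is pointwise. *)
Definition signal (R : realType) (N d : nat) := {ffun 'I_N -> 'cV[R]_d}.

Definition dataset (R : realType) (m p N : nat) : Type :=
  (signal R N m * signal R N p)%type.

(* Only the values of [v] on [0, N - 1] matter; [v] is any extension of the
   recorded input. *)
Definition trajectory (R : realType) (n m p N : nat) (s : lti R n m p)
    (u : signal R N m) (y : signal R N p) : Prop :=
  exists (x0 : 'cV[R]_n) (v : nat -> 'cV[R]_m),
    forall k : 'I_N, v k = u k /\ y k = output s x0 v k.

Definition attack_free (R : realType) (n m p N : nat) (s : lti R n m p)
    (D : dataset R m p N) : Prop :=
  trajectory s D.1 D.2.

Definition poisoning_attack (R : realType) (p sp N : nat)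
    (a : signal R N p) : Prop :=
  forall (k : 'I_N) (i : 'I_p), i \in protected p sp -> a k i 0 = 0.

Definition poisoned (R : realType) (n m p N : nat) (s : lti R n m p)
    (a : signal R N p) (D : dataset R m p N) : Prop :=
  exists (u : signal R N m) (y : signal R N p),
    trajectory s u y /\ D = (u, [ffun k => y k + a k]).

Inductive verdict := Attack | NoAttack.

Definition detector (R : realType) (m p N : nat) : Type :=
  dataset R m p N -> verdict.

Definition identifier (R : realType) (m p N : nat) : Type :=
  dataset R m p N -> {set 'I_p}.

(* Main.v *)
(* Overwrite the output row of an unprotected index without losing any
   information about the state: double it if it is nonzero, otherwise replace it
   by a coordinate functional. The state equation is untouched, so the two
   systems driven by the same input from the same initial state differ only in
   that output, and the attack is this difference. *)
Require Import Defs.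
From HB Require Import structures.
From mathcomp Require Import all_boot all_order all_algebra.
From mathcomp Require Import reals.

Set Implicit Arguments.
Unset Strict Implicit.
Unset Printing Implicit Defensive.
Import Order.TTheory GRing.Theory Num.Theory.
Local Open Scope ring_scope.

Definition with_output (R : realType) (n m p q : nat) (s : lti R n m p)
    (C : 'M[R]_(q, n)) : lti R n m q := LTI (Amx s) (Bmx s) C.

Lemma state_with_output (R : realType) (n m p q : nat) (s : lti R n m p)
    (C : 'M[R]_(q, n)) x0 u k : state (with_output s C) x0 u k = state s x0 u k.
Proof. by elim: k => //= k ->. Qed.

(** Controllability depends only on the unchanged state equation. Equal outputs through [C] remain
    equal after applying [M], so observability through [M *m C] passes to [C], with the same horizon
    [T]. *)
Lemma minimal_with_output (R : realType) (n m p q : nat) (s : lti R n m p)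
    (M : 'M[R]_(p, q)) (C : 'M[R]_(q, n)) :
  Cmx s = M *m C -> minimal s -> minimal (with_output s C).
Proof.
move=> CE [ctr [T obs]]; split=> [x0 xf|].
  by have [t [u <-]] := ctr x0 xf; exists t, u; rewrite state_with_output.
exists T => u x0 x1 eq_out; apply: (obs u) => k /eq_out.
by rewrite /output !state_with_output /= CE -!mulmxA => ->.
Qed.

(** The factor [M] certifies that the new outputs determine the old ones; the column [j] supplies an
    initial state that exposes the change. *)
Lemma exists_row_change (R : realType) (n p : nat) (C : 'M[R]_(p, n))
    (i0 : 'I_p) : (0 < n)%N ->
  exists (C' : 'M[R]_(p, n)) (M : 'M[R]_p) (j : 'I_n),
    [/\ C = M *m C', C i0 j != C' i0 j
      & forall i, i != i0 -> row i C = row i C'].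
Proof.
move=> n_gt0; pose E : 'M[R]_p := delta_mx i0 i0.
have EE : E *m E = E by rewrite mul_delta_mx.
have row_E q (A : 'M[R]_(p, q)) i : i != i0 -> row i (E *m A) = 0.
  by move=> ne; rewrite row_mul rowE mul_delta_mx_0 // mul0mx.
have EA j (A : 'M[R]_(p, n)) : (E *m A) i0 j = A i0 j.
  rewrite mxE (bigD1 i0) //= big1 ?addr0 => [|i ne].
    by rewrite mxE !eqxx mul1r.
  by rewrite mxE (negbTE ne) andbF mul0r.
case: (pickP (fun j => C i0 j != 0)) => [j Cj | C0].
(* Since [E] is idempotent, [1%:M - 2^-1 *: E] is the inverse of [1%:M + E], which doubles row
   [i0]. *)
- exists (C + E *m C), (1%:M - 2^-1 *: E), j; split.
  + rewrite mulmxBl mul1mx mulmxDr -!scalemxAl mulmxA EE -scalerDr -mulr2n.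
    by rewrite -scaler_nat scalerA mulVf ?pnatr_eq0 // scale1r addrK.
  + by rewrite mxE EA -subr_eq0 opprD addNKr oppr_eq0.
  + by move=> i ne; rewrite raddfD /= row_E ?addr0.
- pose j := Ordinal n_gt0.
  have EC : E *m C = 0.
    apply/matrixP=> i k; rewrite [RHS]mxE; have [->|ne] := eqVneq i i0.
      by rewrite EA; apply/eqP; rewrite -[_ == 0]negbK C0.
    by move/rowP: (row_E _ C i ne) => /(_ k); rewrite !mxE.
  (* Here [M] is singular: it erases row [i0], which restores [C] because that row was zero. *)
  exists (C + delta_mx i0 j), (1%:M - E), j; split.
  + by rewrite mulmxBl mul1mx mulmxDr EC add0r mul_delta_mx addrK.
  + by rewrite !mxE !eqxx -subr_eq0 opprD addNKr oppr_eq0 oner_eq0.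
  + by move=> i ne; rewrite raddfD /= -(mul_delta_mx i0) row_E ?addr0.
Qed.

Theorem proposition1 (R : realType) (n m p sp N : nat)
    (n_gt0 : (0 < n)%N) (m_gt0 : (0 < m)%N) (p_gt0 : (0 < p)%N)
    (N_gt0 : (0 < N)%N) (le_sp_p : (sp <= p)%N)
    (sbar : lti R n m p) (sbar_min : minimal sbar)
    (U_neq0 : unprotected p sp != set0) :
  exists (D0 : dataset R m p N) (n' : nat) (s' : lti R n' m p)
         (a : signal R N p) (D : dataset R m p N),
    [/\ attack_free sbar D0,
        (0 < n')%N /\ minimal s',
        (exists k : 'I_N, a k != 0) /\ poisoning_attack sp a,
        poisoned s' a D /\ D0 = D
      & (forall det : detector R m p N, det D0 = det D) /\
        (forall idf : identifier R m p N, idf D0 = idf D)].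
Proof.
have [i0 Ui0] := set0Pn _ U_neq0.
have [C' [M [j [CE Cj eq_row]]]] := exists_row_change (Cmx sbar) i0 n_gt0.
pose s' := with_output sbar C'.
(* From this state the output at time 0 is column [j] of the output matrix, so the attack is already
   nonzero there in entry [i0]. *)
pose x0 : 'cV[R]_n := delta_mx j 0; pose v (k : nat) : 'cV[R]_m := 0.
pose u : signal R N m := [ffun k : 'I_N => v k].
pose y : signal R N p := [ffun k : 'I_N => output sbar x0 v k].
pose y' : signal R N p := [ffun k : 'I_N => output s' x0 v k].
pose a : signal R N p := [ffun k => y k - y' k].
exists (u, y), n, s', a, (u, y); split=> //.
- by exists x0, v => k; rewrite !ffunE.
- by split=> //; apply: (minimal_with_output CE).
- split.
    exists (Ordinal N_gt0); apply: contraNneq Cj => /colP/(_ i0).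
    rewrite !ffunE /output /= -!colE !mxE => /eqP.
    by rewrite subr_eq0.
  move=> k i; have [->|ne _] := eqVneq i i0.
    by move: Ui0; rewrite inE => /negbTE ->.
  (* The states coincide, so the attack is [Cmx s - C'] applied to the common state, for [s] the
     given system [sbar]; only row [i0] of this difference can be nonzero. *)
  rewrite !ffunE /output state_with_output -mulmxBl.
  have: row i (Cmx sbar - C') = 0 by rewrite raddfB /= eq_row ?subrr.
  by move=> r0; move/rowP: (row_mul i (Cmx sbar - C') (state sbar x0 v k))
    => /(_ 0); rewrite r0 mul0mx !mxE.
- split=> //; exists u, y'; split; first by exists x0, v => k; rewrite !ffunE.
  by congr pair; apply/ffunP=> k; rewrite !ffunE addrC subrK.
Qed.
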